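(* Let $P$ be a Markov transition matrix on a state space $\mathcal{X}$ of size $N$. Suppose $P\in\overline{\mathcal{R}_N}$ is reversible with respect to its stationary distribution $\pi$ and its eigenvalues $0\leq\beta_1\leq\cdots\leq\beta_{N-1}<\beta_N=1$ are nonnegative. For $1\leq j\leq N-1$, let $\tau_j$ be independent geometric random variables with mean $1/(1-\beta_j)$; that is, for integers $t\geq 1$, $\mathbf{P}(\tau_j=t)=\beta_j^{t-1}(1-\beta_j)$. Then for any probability distribution $\mu$ on $\mathcal{X}$ and any integer $t\geq 0$, \[ d_{\mathrm{sep}}(P^t(\mu,\cdot),\pi)\leq\mathbf{P}(\tau_1+\cdots+\tau_{N-1}>t). \]
   Context: A Markov transition matrix $P$ on a finite set $\mathcal{X}$ is reversible with respect to a probability distribution $\pi$ if $\pi(x)P(x,y)=\pi(y)P(y,x)$ for all $x,y\in\mathcal{X}$. Let $\mathcal{R}_N$ denote the set of $N\times N$ Markov transition matrices that are reversible with respect to a stationary distribution $\pi$ with $\min_x\pi(x)>0$, and let $\overline{\mathcal{R}_N}$ be the closure of $\mathcal{R}_N$ in $\mathbf{R}^{N^2}$ (so the stationary distribution of a matrix in $\overline{\mathcal{R}_N}$ may have zero entries). Eigenvalues are listed with algebraic multiplicity. Measures are row vectors: $P^t(\mu,\cdot)=\mu P^t=\sum_{x\in\mathcal{X}}\mu(x)P^t(x,\cdot)$. The separation distance between probability measures $\mu,\nu$ on $\mathcal{X}$ is \[ d_{\mathrm{sep}}(\mu,\nu)=\max_{x\in\mathcal{X}}\left[1-\frac{\mu(x)}{\nu(x)}\right],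 \] where the maximum is taken over those $x$ with $\nu(x)>0$. The convention $0^0=1$ is used in the geometric law. *)

(* Defs.v *)
From HB Require Import structures.
From mathcomp Require Import all_boot all_order all_algebra.
From mathcomp Require Import all_classical all_reals all_analysis.

Set Implicit Arguments.
Unset Strict Implicit.
Unset Printing Implicit Defensive.

Import Order.TTheory GRing.Theory Num.Theory.
Import numFieldNormedType.Exports.

Local Open Scope classical_set_scope.
Local Open Scope ring_scope.

Section MarkovChains.
Context {R : realType} {N : nat}.
Implicit Types (P : 'M[R]_N) (mu nu pi : 'rV[R]_N).

Definition prob_vector mu : Prop :=
  (forall x, 0 <= mu 0 x) /\ \sum_x mu 0 x = 1.

Definition transition_matrix P : Prop :=
  (forall x y, 0 <= P x y) /\ (forall x, \sum_y P x y = 1).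

Definition stationary P pi : Prop := prob_vector pi /\ pi *m P = pi.

Definition reversible P pi : Prop :=
  forall x y, pi 0 x * P x y = pi 0 y * P y x.

Definition reversible_matrices : set 'M[R]_N :=
  [set P | transition_matrix P /\
     exists pi, [/\ stationary P pi, reversible P pi & forall x, 0 < pi 0 x]].

(* -oo is the neutral element of maxe, so this is the plain maximum over the
   support of nu as soon as that support is nonempty. *)
Definition dsep mu nu : \bar R :=
  \big[maxe/-oo%E]_(x < N | 0 < nu 0 x) (1 - mu 0 x / nu 0 x)%:E.

End MarkovChains.

Section RandomVariables.
Context d (T : measurableType d) (R : realType) (Pr : probability T R).

Definition mutually_independent (I : finType) d' (T' : measurableType d')
    (X : I -> {RV Pr >-> T'}) : Prop :=
  forall (J : {set I}) (A : I -> set T'), (forall i, measurable (A i)) ->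
    Pr (\bigcap_(i in [set` J]) (X i @^-1` A i)) =
    \big[*%E/1%E]_(i in J) Pr (X i @^-1` A i).

(* Number of Bernoulli trials up to and including the first success, where
   each trial fails with probability b; supported on the positive integers. *)
Definition geometric_rv (X : {RV Pr >-> nat}) (b : R) : Prop :=
  forall t : nat, (1 <= t)%N -> Pr (X @^-1` [set t]) = (b ^+ t.-1 * (1 - b))%:E.

End RandomVariables.

(* Main.v *)
Require Import Defs.
From mathcomp Require Import all_boot all_order all_algebra.
From mathcomp Require Import all_classical all_reals all_analysis.
From mathcomp Require Import complex ring.

Import Order.TTheory GRing.Theory Num.Theory.
Import numFieldNormedType.Exports.

(** Write [b 0 <= ... <= b n = 1] for the eigenvalues of [P], and let [Q m] be the
    product of the [(P - b j) / (1 - b j)] for [j < m] ([local_equilibrium]). Then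
    [Q 0 = 1], the rows of [Q n] are all equal to [pi], and
    [P Q m = b m Q m + (1 - b m) Q (m + 1)]. Hence [P ^ t] is the mixture of the
    [Q m] by the law at time [t] of the pure birth chain on [0, ..., n] that stays at
    [m] with probability [b m]. This chain reaches [n] at a time distributed as
    [tau_1 + ... + tau_n], so if every [Q m] is nonnegative, then
    [mu P ^ t >= Pr (tau_1 + ... + tau_n <= t) pi] entrywise, which is the bound on
    separation ([separation_bound]).

    The nonnegativity of the [Q m] is a theorem of Micchelli and Willoughby for
    symmetric nonnegative matrices ([micchelli_willoughby]). It rests on the Newton
    expansion of the adjugate of [X - M] along the spectrum of [M]
    ([adjugate_newton]) and on one half of Cauchy interlacing for principal minors
    ([symmetric_minor_spectrum]). A matrix that is reversible with respect to a
    positive [pi] is conjugate to a symmetric one by a positive diagonal matrix, and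
    the closure is reached by compactness of the set of possible spectra
    ([closure_reversible_shift_prod_ge0]).

    The law of the sum of the [tau_j] is computed in [geometric_sum_law]; it obeys
    the same recursion as the absorption time of the birth chain
    ([geometric_sum_cdfS]). That the rows of [Q n] are [pi] uses that [1] is a simple
    eigenvalue, through the adjugate of [1 - P] ([local_equilibrium_last]). *)

Set Implicit Arguments.
Unset Strict Implicit.
Unset Printing Implicit Defensive.

Local Open Scope ring_scope.

(** * Adjugate of a characteristic matrix *)

(** The product of the shifts [M - x] for [x] in [s]; the factors commute, so
    only the multiset [s] matters mathematically. *)
Definition shift_prod (R : nzRingType) (n : nat) (M : 'M[R]_n) (s : seq R) : 'M[R]_n :=
  \prod_(x <- s) (M - x%:M).

Lemma shift_prod_cons (R : nzRingType) (n : nat) (M : 'M[R]_n) (x : R) (s : seq R) :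
  shift_prod M (x :: s) = (M - x%:M) *m shift_prod M s.
Proof. by rewrite /shift_prod big_cons. Qed.

Lemma shift_prod_annihilates (R : comNzRingType) (n : nat) (M : 'M[R]_n) (s : seq R) :
  char_poly M = \prod_(x <- s) ('X - x%:P) -> shift_prod M s = 0.
Proof.
case: n M => [|n] M chM; first by apply/matrixP=> -[k ltk].
rewrite -(Cayley_Hamilton M) chM rmorph_prod /=.
by apply: eq_bigr => x _; rewrite rmorphB /= horner_mx_X horner_mx_C.
Qed.

Lemma char_poly_neq0 (R : nzRingType) (n : nat) (M : 'M[R]_n) :
  char_poly M != 0.
Proof. exact/monic_neq0/char_poly_monic. Qed.

Lemma scalemx_inj (R : idomainType) (m n : nat) (a : R) :
  a != 0 -> injective (fun A : 'M[R]_(m, n) => a *: A).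
Proof.
move=> a0 A B /matrixP AB; apply/matrixP=> i j; apply: (mulfI a0).
by have := AB i j; rewrite !mxE.
Qed.

(** Newton expansion of the adjugate of [X - M] along the eigenvalues of [M]:
    both sides become [char_poly M] when multiplied by [X - M], the right-hand
    side because it telescopes and by Cayley-Hamilton. *)
Lemma adjugate_newton (R : idomainType) (n : nat) (M : 'M[R]_n) (s : seq R) :
  char_poly M = \prod_(x <- s) ('X - x%:P) ->
  \adj (char_poly_mx M) =
  \sum_(c < size s) (\prod_(x <- take c s) ('X - x%:P)) *:
     map_mx polyC (shift_prod M (drop c.+1 s)).
Proof.
move=> chM; set B := RHS.
have XB : char_poly_mx M *m B = (char_poly M)%:M.
  pose T c : 'M[{poly R}]_n :=
    (\prod_(x <- take c s) ('X - x%:P)) *: map_mx polyC (shift_prod M (drop c s)).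
  transitivity (\sum_(0 <= c < size s) (T c.+1 - T c)).
    rewrite big_mkord mulmx_sumr; apply: eq_bigr => c _.
    rewrite /T (take_nth 0) // -cats1 big_cat big_seq1 /= (drop_nth 0 (ltn_ord c)).
    rewrite shift_prod_cons map_mxM map_mxB map_scalar_mx /=.
    rewrite -scalerA -scalerBr -scalemxAr; congr (_ *: _).
    rewrite /char_poly_mx -mul_scalar_mx -mulmxBl; congr (_ *m _).
    by rewrite [in RHS]raddfB /= opprB addrA subrK.
  rewrite telescope_sumr // /T take_size drop_size drop0 take0.
  rewrite (shift_prod_annihilates chM) map_mx0 scaler0 subr0.
  by rewrite /shift_prod big_nil map_scalar_mx /= scale_scalar_mx mulr1 chM.
have := congr1 (mulmx (\adj (char_poly_mx M))) XB.
rewrite mulmxA mul_adj_mx mul_scalar_mx mul_mx_scalar.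
by move=> /(scalemx_inj (char_poly_neq0 M)).
Qed.

Lemma adjugate_char_poly_diag (R : comNzRingType) (n : nat) (M : 'M[R]_n.+1) (i : 'I_n.+1) :
  \adj (char_poly_mx M) i i = char_poly (row' i (col' i M)).
Proof.
by rewrite mxE /cofactor addnn -signr_odd odd_double mul1r row'_col'_char_poly_mx.
Qed.

(** Row [i] of the adjugate of [X - M] is orthogonal to the other columns of
    [X - M]; solving for its off-diagonal entries expresses them through the
    adjugate of the principal minor. *)
Lemma adjugate_char_poly_offdiag (R : idomainType) (n : nat) (M : 'M[R]_n.+1)
    (i : 'I_n.+1) (j : 'I_n) (A := row' i (col' i M)) :
  \adj (char_poly_mx M) i (lift i j) =
  \sum_l (M i (lift i l))%:P * \adj (char_poly_mx A) l j.
Proof.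
pose g : 'rV_n := \row_l \adj (char_poly_mx M) i (lift i l).
pose b : 'rV_n := \row_l (M i (lift i l))%:P.
have gA : g *m char_poly_mx A = char_poly A *: b.
  apply/rowP=> k; have /matrixP/(_ i (lift i k)) := mul_adj_mx (char_poly_mx M).
  rewrite mxE (bigD1_ord i) //= adjugate_char_poly_diag => E.
  move: E; rewrite !mxE (negPf (neq_lift i k)) mulr0n sub0r mulrN => /eqP.
  rewrite mulr0n addrC subr_eq0 => /eqP E; rewrite -E.
  by apply: eq_bigr => l _; rewrite !mxE (inj_eq lift_inj).
have := congr1 (mulmx^~ (\adj (char_poly_mx A))) gA.
rewrite -mulmxA mul_mx_adj mul_mx_scalar -scalemxAl.
move=> /(scalemx_inj (char_poly_neq0 A)) /rowP/(_ j); rewrite !mxE => ->.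
by apply: eq_bigr => l _; rewrite !mxE.
Qed.

(** * Spectra of symmetric matrices and of their minors *)

Section Spectrum.
Local Open Scope sesquilinear_scope.
Local Open Scope complex_scope.

(** Vectors supported on [S] and on [T] are sent by [X] and [Y] into a space of
    dimension less than [#|S| + #|T|], hence some nontrivial pair has a common
    image. *)
Lemma supported_dependence (F : fieldType) (p q n : nat) (X : 'M[F]_(p, n))
    (Y : 'M[F]_(q, n)) (S : {set 'I_p}) (T : {set 'I_q}) :
  (n < #|S| + #|T|)%N ->
  exists x : 'rV_p, exists y : 'rV_q,
    [/\ (x != 0) || (y != 0), forall j, j \notin S -> x 0 j = 0,
        forall j, j \notin T -> y 0 j = 0 & x *m X = y *m Y].
Proof.
move=> ltn; pose fS := fun k : 'I_#|S| => enum_val k.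
pose fT := fun k : 'I_#|T| => enum_val k.
pose G := col_mx (rowsub fS X) (rowsub fT Y).
have : kermx G != 0.
  rewrite kermx_eq0 /row_free neq_ltn; apply/orP; left.
  exact: leq_ltn_trans (rank_leq_col G) ltn.
move=> /rowV0Pn[z /sub_kermxP zG z0].
have rowsub1E m r (f : 'I_m -> 'I_r) (u : 'rV[F]_m) j :
    (u *m rowsub f 1%:M) 0 j = \sum_k u 0 k *+ (f k == j).
  rewrite mxE; apply: eq_bigr => k _; rewrite !mxE. by rewrite mulr_natr.
have suppE m r (f : 'I_m -> 'I_r) (u : 'rV[F]_m) (A : {set 'I_r}) j :
    (forall k, f k \in A) -> j \notin A -> (u *m rowsub f 1%:M) 0 j = 0.
  move=> fA jA; rewrite rowsub1E big1 // => k _; case: eqP => // fk.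
  by rewrite -fk fA in jA.
have inj0 m r (f : 'I_m -> 'I_r) (u : 'rV[F]_m) :
    injective f -> u *m rowsub f 1%:M = 0 -> u = 0.
  move=> fI u0; apply/rowP=> k; have /rowP/(_ (f k)) := u0.
  rewrite rowsub1E (bigD1 k) //= eqxx big1 ?addr0 ?mxE // => l /negPf nlk.
  by rewrite (inj_eq fI) nlk.
exists (lsubmx z *m rowsub fS 1%:M), (- rsubmx z *m rowsub fT 1%:M); split.
- rewrite -negb_and; apply: contra z0 => /andP[/eqP x0 /eqP y0].
  rewrite -[z]hsubmxK (inj0 _ _ _ _ (@enum_val_inj _ _) x0).
  have /eqP := inj0 _ _ _ _ (@enum_val_inj _ _) y0.
  by rewrite oppr_eq0 => /eqP ->; rewrite row_mx0.
- by move=> j; apply: suppE => k; exact: enum_valP.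
- by move=> j; apply: suppE => k; exact: enum_valP.
- rewrite -!mulmxA -!rowsubE mulNmx; apply/eqP; rewrite -subr_eq0 opprK.
  by rewrite -mul_row_col hsubmxK zG.
Qed.

Lemma diag_form (C : numClosedFieldType) (n : nat) (x : 'rV[C]_n) (d : 'rV[C]_n) :
  (x *m diag_mx d *m x^t*) 0 0 = \sum_j d 0 j * `|x 0 j| ^+ 2.
Proof.
rewrite mxE; apply: eq_bigr => j _; rewrite mul_mx_diag !mxE normCK.
by rewrite mulrAC mulrC.
Qed.

Lemma square_form (C : numClosedFieldType) (n : nat) (x : 'rV[C]_n) :
  (x *m x^t*) 0 0 = \sum_j `|x 0 j| ^+ 2.
Proof. by rewrite mxE; apply: eq_bigr => j _; rewrite !mxE normCK. Qed.

(** One half of Cauchy interlacing, in counting form. If a principal minor had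
    more eigenvalues above [c] than [M], some nonzero vector would lie both in
    the span of the eigenvectors of the minor above [c] and in the span of those
    of [M] at most [c], where the form of [M - c] has opposite signs. *)
Lemma minor_eigenvalue_count (C : numClosedFieldType) (n : nat) (M : 'M[C]_n.+1) (i : 'I_n.+1)
    (U : 'M[C]_n.+1) (d : 'rV[C]_n.+1) (V : 'M[C]_n) (e : 'rV[C]_n) (c : C) :
  U \is unitarymx -> V \is unitarymx ->
  M = U^t* *m diag_mx d *m U -> row' i (col' i M) = V^t* *m diag_mx e *m V ->
  d \is a realmx -> c \is Num.real ->
  (#|[set j | (c < e 0 j)%R]| <= #|[set j | (c < d 0 j)%R]|)%N.
Proof.
move=> Uu Vu ME AE dr cr; rewrite leqNgt; apply/negP => lt_card.
(* Row vectors of the minor are padded by a zero in position [i]. *)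
pose E : 'M[C]_(n, n.+1) := rowsub (lift i) 1%:M.
have EA : E *m M *m E^t* = row' i (col' i M).
  apply/matrixP=> j k; rewrite -rowsubE mxE (bigD1 (lift i k)) //= !mxE eqxx.
  rewrite conjC1 mulr1 big1 ?addr0 // => l /negPf nl.
  by rewrite !mxE eq_sym nl conjC0 mulr0.
have EE : E *m E^t* = 1%:M.
  apply/matrixP=> j k; rewrite -rowsubE !mxE.
  by rewrite (inj_eq lift_inj) conjC_nat eq_sym.
have UU := unitarymxP Uu; have VV := unitarymxP Vu.
pose S := [set j | c < e 0 j]; pose T := ~: [set j | c < d 0 j].
have ltn : (n.+1 < #|S| + #|T|)%N.
  by rewrite [X in (X < _)%N](_ : _ = #|[set j | (c < d 0 j)%R]| + #|T|)%N
    ?ltn_add2r // cardsC card_ord.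
have [x [y [xy0 xS yT xVyU]]] := supported_dependence (V *m E) U ltn.
have sq : \sum_j `|x 0 j| ^+ 2 = \sum_j `|y 0 j| ^+ 2.
  have := congr1 (fun w => (w *m w^t*) 0 0) xVyU.
  rewrite !trmx_mul !map_mxM !mulmxA -(mulmxA _ E) EE mulmx1.
  by rewrite -(mulmxA _ V) VV -(mulmxA _ U) UU !mulmx1 !square_form.
have qu : \sum_j e 0 j * `|x 0 j| ^+ 2 = \sum_j d 0 j * `|y 0 j| ^+ 2.
  have := congr1 (fun w => (w *m M *m w^t*) 0 0) xVyU.
  rewrite !trmx_mul !map_mxM !mulmxA.
  rewrite -(mulmxA _ E M) -(mulmxA _ (E *m M)) EA AE ME !mulmxA.
  rewrite -(mulmxA _ V) VV -(mulmxA _ U) UU mulmx1 mulmx1.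
  by rewrite -(mulmxA _ V) VV -(mulmxA _ U) UU mulmx1 mulmx1 !diag_form.
have key : \sum_j (e 0 j - c) * `|x 0 j| ^+ 2 = \sum_j (d 0 j - c) * `|y 0 j| ^+ 2.
  under eq_bigr do rewrite mulrBl; under [RHS]eq_bigr do rewrite mulrBl.
  by rewrite !sumrB qu -!mulr_sumr sq.
have L0 j : 0 <= (e 0 j - c) * `|x 0 j| ^+ 2.
  have [|jS] := boolP (j \in S); last by rewrite xS // normr0 expr0n mulr0.
  by rewrite inE => /ltW le; rewrite mulr_ge0 ?subr_ge0 ?exprn_ge0.
have R0 : \sum_j (d 0 j - c) * `|y 0 j| ^+ 2 <= 0.
  apply: sumr_le0 => j _.
  have [|jT] := boolP (j \in T); last by rewrite yT // normr0 expr0n mulr0.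
  rewrite !inE -real_leNgt ?(mxOverP dr) // => le.
  by rewrite mulr_le0_ge0 ?subr_le0 ?exprn_ge0.
have x0 : x = 0.
  apply/rowP=> j; rewrite mxE.
  have [|jS] := boolP (j \in S); last by rewrite xS.
  rewrite inE => lt; have : \sum_j (e 0 j - c) * `|x 0 j| ^+ 2 = 0.
    by apply/le_anti; rewrite {1}key R0 sumr_ge0.
  move=> /(psumr_eq0P (fun k _ => L0 k))/(_ j isT)/eqP; rewrite mulf_eq0 subr_eq0 gt_eqF //=.
  by rewrite sqrf_eq0 normr_eq0 => /eqP.
have y0 : y = 0.
  apply/rowP=> j; rewrite mxE.
  have : \sum_j `|y 0 j| ^+ 2 = 0.
    by rewrite -sq x0 big1 // => k _; rewrite mxE normr0 expr0n.
  move=> /psumr_eq0P E0; have /eqP := E0 (fun k _ => exprn_ge0 2 (normr_ge0 _)) j isT.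
  by rewrite sqrf_eq0 normr_eq0 => /eqP.
by rewrite x0 y0 !eqxx in xy0.
Qed.

Lemma char_poly_conj (F : comNzRingType) (n : nat) (Q A P : 'M[F]_n) :
  Q *m P = 1%:M -> char_poly (Q *m A *m P) = char_poly A.
Proof.
move=> QP; rewrite /char_poly.
have -> : char_poly_mx (Q *m A *m P) =
    map_mx polyC Q *m char_poly_mx A *m map_mx polyC P.
  rewrite /char_poly_mx mulmxBr mulmxBl -!map_mxM mul_mx_scalar -scalemxAl.
  by rewrite -map_mxM QP map_mx1 scalemx1.
by rewrite !det_mulmx mulrAC -det_mulmx -map_mxM QP map_mx1 det1 mul1r.
Qed.

Lemma char_poly_diag (F : fieldType) (n : nat) (d : 'rV[F]_n) :
  char_poly (diag_mx d) = \prod_j ('X - (d 0 j)%:P).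
Proof.
rewrite char_poly_trig ?diag_mx_is_trig //.
by apply: eq_bigr => j _; rewrite mxE eqxx.
Qed.

(** Spectral theorem for a real symmetric matrix; the orthonormal eigenbasis is
    taken over the complex numbers, the eigenvalues are real. *)
Lemma symmetric_spectral (R : rcfType) (n : nat) (M : 'M[R]_n) :
  M^T = M -> exists U : 'M[R[i]]_n, exists d : 'rV[R]_n,
    [/\ U \is unitarymx,
        map_mx (real_complex R) M = U^t* *m diag_mx (map_mx (real_complex R) d) *m U
      & char_poly M = \prod_j ('X - (d 0 j)%:P)].
Proof.
move=> symM; set MC := map_mx _ M.
have hM : MC \is hermsymmx.
  apply: realsym_hermsym; last first.
    by apply/mxOverP=> j k; rewrite mxE complex_real.
  by apply/is_hermitianmxP; rewrite expr0 scale1r map_mx_id // /MC map_trmx symM.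
have /orthomx_spectralP := hermitian_normalmx hM.
have Uu := spectral_unitarymx MC; set U := spectralmx MC in Uu *.
have := hermitian_spectral_diag_real hM; set e := spectral_diag MC => er ME.
pose d := map_mx (@complex.Re R) e.
have de : map_mx (real_complex R) d = e.
  by apply/matrixP=> j k; rewrite !mxE RRe_real // (mxOverP er).
exists U, d; split => //; first by rewrite de -invmx_unitary.
apply: (@map_poly_inj _ _ (real_complex R)).
rewrite map_char_poly -/MC ME char_poly_conj ?mulVmx ?unitarymx_unit // -de char_poly_diag.
rewrite rmorph_prod; apply: eq_bigr => j _ /=.
by rewrite rmorphB /= map_polyX map_polyC /= mxE.
Qed.

Lemma sorted_ge_domination (R : realDomainType) (s m : seq R) :
  sorted >=%R s -> sorted >=%R m -> (size m <= size s)%N ->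
  (forall c, count (> c) m <= count (> c) s)%N ->
  forall k, (k < size m)%N -> m`_k <= s`_k.
Proof.
move=> srts srtm lems cnt k ltk; rewrite leNgt; apply/negP => lt.
have lts := leq_trans ltk lems.
(* At the level [s`_k], at most [k] entries of [s] are larger, but at least [k + 1] of [m]. *)
have cs : (count (> s`_k)%R s <= k)%N.
  rewrite -[s in count _ s](cat_take_drop k) count_cat.
  rewrite [X in (_ + X)%N](_ : _ = 0%N) ?addn0.
    by rewrite (leq_trans (count_size _ _)) // size_take_min geq_minl.
  apply/eqP; rewrite -leqn0 leqNgt -has_count; apply/hasPn => x.
  move=> /(nthP 0)[j]; rewrite size_drop nth_drop => ltj <-; rewrite -leNgt.
  apply: (sorted_leq_nth ge_trans (@lexx _ R) 0 srts) => //; last exact: leq_addr.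
  by rewrite inE -ltn_subRL.
have cm : (k < count (> s`_k)%R m)%N.
  rewrite -[m in count _ m](cat_take_drop k.+1) count_cat.
  apply: leq_trans (leq_addr _ _).
  rewrite (_ : count _ _ = k.+1) //; rewrite -[RHS](size_takel ltk).
  apply/eqP; rewrite -all_count; apply/allP => x.
  move=> /(nthP 0)[j]; rewrite size_takel // => ltj <-; rewrite nth_take //.
  apply: lt_le_trans lt _.
  by apply: (sorted_leq_nth ge_trans (@lexx _ R) 0 srtm); rewrite ?inE // (leq_trans ltj).
by have := leq_trans cm (leq_trans (cnt _) cs); rewrite ltnn.
Qed.

(** Half of Cauchy interlacing for sorted spectra: the [k]-th largest eigenvalue
    of a principal minor is at most the [k]-th largest one of the matrix. *)
Lemma symmetric_minor_spectrum (R : rcfType) (n : nat) (M : 'M[R]_n.+1)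
    (s : seq R) (i : 'I_n.+1) :
  M^T = M -> sorted >=%R s -> char_poly M = \prod_(x <- s) ('X - x%:P) ->
  exists m : seq R, [/\ sorted >=%R m,
    char_poly (row' i (col' i M)) = \prod_(x <- m) ('X - x%:P) &
    forall k, (k < size m)%N -> m`_k <= s`_k].
Proof.
move=> symM srts chM.
have [U [d [Uu ME chd]]] := symmetric_spectral symM.
have symA : (row' i (col' i M))^T = row' i (col' i M).
  by apply/matrixP=> u v; rewrite !mxE -[in RHS]symM mxE.
have [V [e [Vu AE che]]] := symmetric_spectral symA.
pose sd := [seq d 0 j | j <- enum 'I_n.+1]; pose se := [seq e 0 j | j <- enum 'I_n].
have perm_s : perm_eq s sd.
  by apply: prod_XsubC_eq; rewrite -chM chd big_map big_enum.
pose m := sort >=%R se.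
have perm_m : perm_eq m se by rewrite perm_sort.
have srtm : sorted >=%R m by apply: sort_sorted; exact: ge_total.
exists m; split => //.
  by rewrite che (perm_big _ perm_m) big_map big_enum.
apply: sorted_ge_domination => //.
  rewrite (perm_size perm_m) (perm_size perm_s) !size_map -!enumT !size_enum_ord.
  exact: leqnSn.
move=> c; rewrite (permP perm_m) (permP perm_s) !count_map.
have := @minor_eigenvalue_count _ _ (map_mx (real_complex R) M) i U
  (map_mx (real_complex R) d) V (map_mx (real_complex R) e) c%:C Uu Vu ME.
rewrite -map_col' -map_row' => /(_ AE).
have rd : map_mx (real_complex R) d \is a realmx.
  by apply/mxOverP=> j k; rewrite mxE complex_real.
move=> /(_ rd); rewrite complex_real eqxx => /(_ isT).
have cntE q (f : 'rV[R]_q) :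
    #|[set j | c%:C < map_mx (real_complex R) f 0 j]| = count (fun j => c < f 0 j) (enum 'I_q).
  have -> : [set j | c%:C < map_mx (real_complex R) f 0 j] = [set j | c < f 0 j].
    by apply/setP=> j; rewrite !finset.in_set mxE ltcR.
  by rewrite cardE size_filter -enumT; apply: eq_count => j;
    rewrite -[LHS]/(j \in _) finset.in_set.
by rewrite !cntE !enumT.
Qed.

End Spectrum.

(** * The Micchelli-Willoughby theorem *)

(** Newton basis polynomials with nodes the successive entries of [s]. *)
Definition newton_basis (R : nzRingType) (s : seq R) (c : nat) : {poly R} :=
  \prod_(x <- take c s) ('X - x%:P).

(** Nonnegative combinations of the first [K] Newton basis polynomials. *)
Definition newton_cone (R : numDomainType) (s : seq R) (K : nat) (p : {poly R}) : Prop :=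
  exists2 a : nat -> R, (forall c, 0 <= a c) & p = \sum_(c < K) a c *: newton_basis s c.

Lemma newton_coef_inj (R : nzRingType) (s : seq R) (K : nat) (a b : nat -> R) :
  (K <= (size s).+1)%N ->
  \sum_(c < K) a c *: newton_basis s c = \sum_(c < K) b c *: newton_basis s c ->
  forall c, (c < K)%N -> a c = b c.
Proof.
elim: K => [//|K IH] leK E.
have coefK : forall f : nat -> R,
    (\sum_(c < K.+1) f c *: newton_basis s c)`_K = f K.
  move=> f; rewrite coef_sum big_ord_recr big1 /= => [|c _].
    rewrite add0r coefZ /newton_basis.
    have /monicP : newton_basis s K \is monic by apply: monic_prod_XsubC.
    rewrite /lead_coef size_prod_XsubC size_takel //= => ->; exact: mulr1.
  rewrite coefZ nth_default ?mulr0 // size_prod_XsubC size_take_min.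
  exact: leq_ltn_trans (geq_minl _ _) (ltn_ord c).
have aK : a K = b K by rewrite -coefK E coefK.
move=> c; rewrite ltnS leq_eqVlt => /predU1P[-> //|ltcK].
apply: IH ltcK; first exact: ltnW.
by move: E; rewrite !big_ord_recr /= aK => /addIr.
Qed.

Lemma newton_cone_sum (R : numDomainType) (s : seq R) (K : nat) (I : Type) (r : seq I)
    (u : I -> R) (p : I -> {poly R}) :
  (forall i, 0 <= u i) -> (forall i, newton_cone s K (p i)) ->
  newton_cone s K (\sum_(i <- r) u i *: p i).
Proof.
move=> u0 pK; elim: r => [|i r [a a0 ra]].
  by exists (fun=> 0) => //; rewrite big_nil big1 // => c _; rewrite scale0r.
have [b b0 rb] := pK i; exists (fun c => u i * b c + a c) => [c|].
  by rewrite addr_ge0 ?mulr_ge0.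
rewrite big_cons ra rb scaler_sumr -big_split; apply: eq_bigr => c _ /=.
by rewrite scalerDl scalerA.
Qed.

Lemma newton_cone_basis (R : numDomainType) (s : seq R) (K c : nat) :
  (c < K)%N -> newton_cone s K (newton_basis s c).
Proof.
move=> ltcK; exists (fun e => (e == c)%:R) => [e|]; first exact: ler0n.
rewrite (bigD1 (Ordinal ltcK)) //= eqxx scale1r big1 ?addr0 // => e /negPf nec.
by rewrite (_ : (e : nat) == c = false) ?scale0r.
Qed.

Lemma newton_cone_widen (R : numDomainType) (s : seq R) (K L : nat) (p : {poly R}) :
  (K <= L)%N -> newton_cone s K p -> newton_cone s L p.
Proof.
move=> leKL [a a0 ->]; apply: newton_cone_sum => // c.
by apply: newton_cone_basis; exact: leq_trans leKL.
Qed.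

Lemma newton_cone_shift (R : numDomainType) (s : seq R) (K c : nat) (u : R) :
  (c < K)%N -> (c < size s)%N -> u <= s`_c ->
  newton_cone s K.+1 (newton_basis s c * ('X - u%:P)).
Proof.
move=> ltcK ltcs leu.
have [a a0 ra] : newton_cone s K.+1 (newton_basis s c.+1) by exact: newton_cone_basis.
have [b b0 rb] : newton_cone s K.+1 (newton_basis s c).
  by apply: newton_cone_basis; exact: leqW.
exists (fun e => a e + (s`_c - u) * b e) => [e|].
  by rewrite addr_ge0 // mulr_ge0 // subr_ge0.
under eq_bigr do rewrite scalerDl -scalerA.
rewrite big_split -scaler_sumr -ra -rb /= {2}/newton_basis (take_nth 0) //.
rewrite -cats1 big_cat big_seq1 /= -/(newton_basis s c) -mul_polyC [_%:P * _]mulrC.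
by rewrite -mulrDr polyCB addrA subrK.
Qed.

(** If [m] is dominated by the decreasing sequence [s], the Newton polynomials of
    [m] have nonnegative coordinates in the Newton basis of [s]: multiply by one
    factor at a time, writing [X - m_k = (X - s_c) + (s_c - m_k)]. *)
Lemma newton_cone_dominated (R : numDomainType) (s m : seq R) (k : nat) :
  sorted >=%R s -> (size m <= size s)%N ->
  (forall i, (i < size m)%N -> m`_i <= s`_i) ->
  (k <= size m)%N -> newton_cone s k.+1 (newton_basis m k).
Proof.
move=> srt les dom; elim: k => [_|k IH ltk].
  have -> : newton_basis m 0 = newton_basis s 0 by rewrite /newton_basis !take0.
  exact: newton_cone_basis.
have [a a0 ra] := IH (ltnW ltk).
rewrite {1}/newton_basis (take_nth 0) // -cats1 big_cat big_seq1 /=.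
rewrite -/(newton_basis m k) ra mulr_suml.
under eq_bigr do rewrite -scalerAl.
apply: newton_cone_sum => // c; apply: newton_cone_shift => //.
  exact: leq_trans (leq_trans (ltn_ord c) ltk) les.
apply: le_trans (dom _ ltk) _.
have := sorted_leq_nth ge_trans (@lexx _ R) 0 srt; apply.
- rewrite inE; exact: leq_trans (leq_trans (ltn_ord c) ltk) les.
- rewrite inE; exact: leq_trans ltk les.
- by rewrite -ltnS.
Qed.

Lemma size_char_poly_roots (F : nzRingType) (n : nat) (M : 'M[F]_n) (s : seq F) :
  char_poly M = \prod_(x <- s) ('X - x%:P) -> size s = n.
Proof.
move=> /(congr1 (size : {poly F} -> nat)).
by rewrite size_char_poly size_prod_XsubC => -[].
Qed.

(** Micchelli-Willoughby: for a symmetric nonnegative matrix, the product of the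
    shifts by any number of its smallest eigenvalues is nonnegative. The proof is
    an induction on the size. By [adjugate_newton] the entries of these products
    are the coordinates of [adj (X - M) i j] in the Newton basis of the spectrum;
    this polynomial is the characteristic polynomial of a minor when [i = j], and
    otherwise a combination, nonnegative by induction, of Newton polynomials of
    the spectrum of a minor. Interlacing and [newton_cone_dominated] conclude. *)
Theorem micchelli_willoughby (R : rcfType) (n : nat) (M : 'M[R]_n) (s : seq R) (k : nat)
    (i j : 'I_n) :
  M^T = M -> (forall i j, 0 <= M i j) -> sorted >=%R s ->
  char_poly M = \prod_(x <- s) ('X - x%:P) ->
  0 <= shift_prod M (drop k s) i j.
Proof.
elim: n M s k i j => [|n IH] M s k i j; first by case: i.
move=> symM M0 srt chM; have sz := size_char_poly_roots chM.
case: k => [|c]; first by rewrite drop0 (shift_prod_annihilates chM) mxE.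
case: (ltnP c (size s)) => [ltcs|les]; last first.
  rewrite drop_oversize; last exact: leqW.
  by rewrite /shift_prod big_nil mxE ler0n.
have [m [srtm chA dom]] := symmetric_minor_spectrum i symM srt chM.
have szm : size m = n := size_char_poly_roots chA.
have lems : (size m <= size s)%N by rewrite sz szm.
have step (a : nat -> R) :
    \adj (char_poly_mx M) i j = \sum_(c < size s) a c *: newton_basis s c ->
    shift_prod M (drop c.+1 s) i j = a c.
  move=> E; pose b e := shift_prod M (drop e.+1 s) i j.
  apply: (@newton_coef_inj _ s (size s) b a) => //.
  rewrite -E (adjugate_newton chM) summxE; apply: eq_bigr => e _.
  by rewrite !mxE mulrC mul_polyC.
suff [a a0 E] : newton_cone s (size s) (\adj (char_poly_mx M) i j) by rewrite (step a).
have coneA e : (e <= size m)%N -> newton_cone s (size s) (newton_basis m e).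
  move=> leem; apply: (@newton_cone_widen _ _ e.+1); first by rewrite sz ltnS -szm.
  exact: newton_cone_dominated.
case: (unliftP i j) => [l ->|->]; last first.
  rewrite adjugate_char_poly_diag chA -[m in \prod_(x <- m) _]take_size.
  exact: coneA.
rewrite adjugate_char_poly_offdiag.
under eq_bigr do rewrite mul_polyC.
apply: newton_cone_sum => // p.
rewrite (adjugate_newton chA) summxE.
under eq_bigr do rewrite !mxE mulrC mul_polyC.
apply: newton_cone_sum => q; last by apply: coneA; exact: ltnW.
apply: IH => //; last by move=> ? ?; rewrite !mxE.
by apply/matrixP=> u v; rewrite !mxE -[in RHS]symM mxE.
Qed.

(** * Reversible matrices *)

Lemma shift_prod_conj (F : comNzRingType) (n : nat) (Q A P : 'M[F]_n) (s : seq F) :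
  P *m Q = 1%:M -> Q *m P = 1%:M ->
  shift_prod (Q *m A *m P) s = Q *m shift_prod A s *m P.
Proof.
move=> PQ QP; elim: s => [|x s IH].
  by rewrite /shift_prod !big_nil mulmx1 QP.
rewrite !shift_prod_cons {}IH.
have -> : (Q *m A *m P - x%:M) = Q *m (A - x%:M) *m P.
  by rewrite mulmxBr mulmxBl mul_mx_scalar -scalemxAl QP scalemx1.
by rewrite !mulmxA -(mulmxA _ P Q) PQ mulmx1.
Qed.

(** For a left eigenvector [v], the l1 norm of [v P] is at most that of [v]. *)
Lemma transition_root_le1 (R : realType) (N : nat) (P : 'M[R]_N) (b : R) :
  transition_matrix P -> root (char_poly P) b -> `|b| <= 1.
Proof.
move=> [P0 P1]; rewrite -eigenvalue_root_char => /eigenvalueP[v vP v0].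
have vpos : 0 < \sum_j `|v 0 j|.
  rewrite lt_def sumr_ge0 ?andbT //; apply: contra v0 => /eqP.
  move=> /(psumr_eq0P (fun j _ => normr_ge0 (v 0 j))) E.
  by apply/eqP/rowP=> j; rewrite mxE; apply/eqP; rewrite -normr_eq0 E.
rewrite -(ler_pM2r vpos) mul1r mulr_sumr.
apply: (@le_trans _ _ (\sum_j \sum_i `|v 0 i| * P i j)).
  apply: ler_sum => j _; rewrite -normrM.
  have -> : b * v 0 j = \sum_i v 0 i * P i j.
    by move/rowP/(_ j): vP; rewrite !mxE => ->.
  apply: le_trans (ler_norm_sum _ _ _) _; apply: ler_sum => i _.
  by rewrite normrM (ger0_norm (P0 _ _)).
rewrite exchange_big /=; apply: ler_sum => i _.
by rewrite -mulr_sumr P1 mulr1.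
Qed.

(** Conjugation by the diagonal matrix of the [sqrt (pi x)] makes [P] symmetric,
    and preserves nonnegativity and the spectrum. *)
Lemma reversible_shift_prod_ge0 (R : realType) (N : nat) (P : 'M[R]_N) (pi : 'rV[R]_N) :
  transition_matrix P -> reversible P pi -> (forall x, 0 < pi 0 x) ->
  exists s : seq R, [/\ sorted >=%R s, char_poly P = \prod_(x <- s) ('X - x%:P) &
    forall k i j, 0 <= shift_prod P (drop k s) i j].
Proof.
move=> [P0 P1] rev pi0.
pose r : 'rV[R]_N := \row_x Num.sqrt (pi 0 x); pose r' : 'rV[R]_N := \row_x (r 0 x)^-1.
have r_gt0 x : 0 < r 0 x by rewrite mxE sqrtr_gt0.
have r_sqr x : pi 0 x = r 0 x * r 0 x by rewrite -expr2 mxE sqr_sqrtr // ltW.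
have rr' : diag_mx r *m diag_mx r' = 1%:M.
  rewrite mulmx_diag -diag_const_mx; congr diag_mx; apply/rowP=> x.
  by rewrite !mxE divff // gt_eqF // sqrtr_gt0.
have r'r : diag_mx r' *m diag_mx r = 1%:M by rewrite -diag_mxC.
pose S := diag_mx r *m P *m diag_mx r'.
have SE x y : S x y = r 0 x * P x y / r 0 y.
  by rewrite /S mul_mx_diag mul_diag_mx !mxE.
have PE : P = diag_mx r' *m S *m diag_mx r.
  by rewrite /S !mulmxA r'r mul1mx -mulmxA r'r mulmx1.
have symS : S^T = S.
  apply/matrixP=> x y; rewrite mxE !SE.
  have rx : r 0 x != 0 by rewrite gt_eqF.
  have ry : r 0 y != 0 by rewrite gt_eqF.
  have := rev x y; rewrite !r_sqr => E.
  apply: (mulfI rx); apply: (mulfI ry).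
  have -> : r 0 y * (r 0 x * (r 0 y * P y x / r 0 x)) = r 0 y * r 0 y * P y x by field.
  by rewrite -E; field.
have S0 x y : 0 <= S x y by rewrite SE divr_ge0 ?mulr_ge0 // ltW.
have [_ [d [_ _ chd]]] := symmetric_spectral symS.
pose s := sort >=%R [seq d 0 j | j <- enum 'I_N].
have srts : sorted >=%R s by apply: sort_sorted; exact: ge_total.
have chS : char_poly S = \prod_(x <- s) ('X - x%:P).
  rewrite chd [RHS](perm_big [seq d 0 j | j <- enum 'I_N]) ?perm_sort //=.
  by rewrite big_map big_enum.
exists s; split => //; first by rewrite PE char_poly_conj.
move=> k i j; rewrite {1}PE shift_prod_conj // mul_mx_diag mul_diag_mx !mxE.
rewrite !mulr_ge0 ?invr_ge0 ?sqrtr_ge0 //.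
exact: micchelli_willoughby.
Qed.

Local Open Scope classical_set_scope.

(** * Closure of the reversible matrices *)

(** A relation with witnesses in a compact set over each point of [A] has a
    witness, for its closure, over each adherent point of [A]. *)
Lemma compact_fiber_closure (T : topologicalType) (U : ptopologicalType) (A : set T)
    (K : set U) (Rel : T -> U -> Prop) (p : T) :
  compact K -> closure A p -> (forall a, A a -> exists2 u, K u & Rel a u) ->
  exists u, closure [set z : T * U | Rel z.1 z.2] (p, u).
Proof.
move=> cK clp ARel.
have [g gP] : exists g : T -> U, forall a, A a -> K (g a) /\ Rel a (g a).
  have /choice[g gP] : forall a, exists u, A a -> K u /\ Rel a u.
    move=> a; have [/ARel[u Ku Ru]|nA] := pselect (A a); first by exists u.
    by exists point.
  by exists g.
have FF : ProperFilter (within A (nbhs p)) by exact: within_nbhs_proper.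
have [|u [Ku clu]] := cK (g @ within A (nbhs p)) _.
  apply: (@filterS _ (nbhs p) _ setT); last exact: filterT.
  by move=> a _ /gP[].
exists u => B [[B1 B2] [/= nB1 nB2] sB].
have [|v [[a [Aa B1a] <-] B2v]] := clu (g @` (A `&` B1)) B2 _ nB2.
  rewrite /= /fmap /= /within /=.
  by apply: filterS nB1 => a B1a Aa; exists a.
by exists (a, g a); split; [exact: (gP a Aa).2 | exact: sB].
Qed.

Lemma continuous_bigsum (R : realType) (T : topologicalType) (I : Type) (r : seq I)
    (F : I -> T -> R) :
  (forall i, continuous (F i)) -> continuous (fun t => \sum_(i <- r) F i t).
Proof.
move=> cF; elim: r => [|i r IH] t.
  by under eq_fun do rewrite big_nil; exact: cvg_cst.
by under eq_fun do rewrite big_cons; apply: continuousD; [exact: cF | exact: IH].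
Qed.

Lemma continuous_bigprod (R : realType) (T : topologicalType) (I : Type) (r : seq I)
    (F : I -> T -> R) :
  (forall i, continuous (F i)) -> continuous (fun t => \prod_(i <- r) F i t).
Proof.
move=> cF; elim: r => [|i r IH] t.
  by under eq_fun do rewrite big_nil; exact: cvg_cst.
by under eq_fun do rewrite big_cons; apply: continuousM; [exact: cF | exact: IH].
Qed.

Lemma continuous_det (R : realType) (T : topologicalType) (N : nat) (A : T -> 'M[R]_N) :
  (forall i j, continuous (fun t => A t i j)) -> continuous (fun t => \det (A t)).
Proof.
move=> cA; apply: continuous_bigsum => s t.
by apply: (@continuousM _ _ (cst _)); [exact: cvg_cst | apply: continuous_bigprod => i; exact: cA].
Qed.

Lemma continuous_shift_prod (R : realType) (T : topologicalType) (N : nat) (I : Type)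
    (A : T -> 'M[R]_N) (b : T -> I -> R) (r : seq I) :
  (forall i j, continuous (fun t => A t i j)) -> (forall i, continuous (b^~ i)) ->
  forall i j, continuous (fun t => shift_prod (A t) [seq b t x | x <- r] i j).
Proof.
move=> cA cb; elim: r => [|x r IH] i j.
  under eq_fun do rewrite /shift_prod big_nil; move=> t; exact: cvg_cst.
under eq_fun do rewrite /= shift_prod_cons mxE.
apply: continuous_bigsum => k t; apply: continuousM; last exact: IH.
suff : continuous (fun t => (A t - (b t x)%:M) i k) by exact.
under eq_fun do rewrite !mxE.
move=> u; apply: (@continuousB _ _ _ (fun t => A t i k) (fun t => b t x *+ (i == k))).
  exact: cA.
by case: (i == k); [exact: cb | exact: cvg_cst].
Qed.

Lemma poly_ext (R : numDomainType) (p q : {poly R}) : (forall x, p.[x] = q.[x]) -> p = q.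
Proof.
move=> pq; apply/eqP; rewrite -subr_eq0; apply/negPn/negP => nz.
have := max_poly_roots nz (rs := [seq i%:R | i <- iota 0 (size (p - q))]).
rewrite size_map size_iota ltnn map_inj_uniq ?iota_uniq; last first.
  by apply: mulrIn; rewrite oner_eq0.
suff -> : all (root (p - q)) [seq i%:R | i <- iota 0 (size (p - q))] by move=> /(_ isT isT).
by apply/allP => x _; rewrite rootE !hornerE pq subrr.
Qed.

Lemma horner_char_poly (R : comNzRingType) (N : nat) (A : 'M[R]_N) (x : R) :
  (char_poly A).[x] = \det (x%:M - A).
Proof.
rewrite -horner_evalE -det_map_mx; congr (\det _); apply/matrixP=> i j.
by rewrite !mxE /= /horner_eval !hornerE hornerMn hornerX.
Qed.

(** Passage to the closure. The spectra of reversible matrices lie in a compact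
    cube, so some [b] is a cluster point of spectra of matrices tending to [P].
    Sortedness, the factorization of the characteristic polynomial and the
    nonnegativity are closed conditions, so [b] is the sorted spectrum of [P]. *)
Lemma closure_reversible_shift_prod_ge0 (R : realType) (n : nat) (P : 'M[R]_n.+1)
    (s : seq R) (k : nat) (i j : 'I_n.+1) :
  closure (reversible_matrices : set 'M[R]_n.+1) P ->
  sorted >=%R s -> char_poly P = \prod_(x <- s) ('X - x%:P) ->
  0 <= shift_prod P (drop k s) i j.
Proof.
move=> clP srts chP; have szs := size_char_poly_roots chP.
pose sq (b : 'rV[R]_n.+1) := [seq b 0 l | l <- enum 'I_n.+1].
pose Rel (A : 'M[R]_n.+1) (b : 'rV[R]_n.+1) := [/\ forall l m : 'I_n.+1, (l <= m)%N -> b 0 m <= b 0 l,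
  char_poly A = \prod_(x <- sq b) ('X - x%:P) &
  forall k i j, 0 <= shift_prod A (drop k (sq b)) i j].
pose K := [set b : 'rV[R]_n.+1 | forall l, `[-1 : R, 1]%classic (b 0 l)].
have cK : compact K.
  by apply: (@rV_compact R _ (fun=> `[-1 : R, 1]%classic)) => l; exact: segment_compact.
have fib : forall A, reversible_matrices A -> exists2 b, K b & Rel A b.
  move=> A [tA [nu [_ rev nu0]]].
  have [r [srtr chA posA]] := reversible_shift_prod_ge0 tA rev nu0.
  have szr := size_char_poly_roots chA.
  pose b : 'rV[R]_n.+1 := \row_l r`_l.
  have sqb : sq b = r.
    apply: (@eq_from_nth _ 0); rewrite size_map size_enum_ord // => l ltl.
    by rewrite (nth_map ord0) ?size_enum_ord // mxE nth_enum_ord.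
  exists b.
    move=> l /=; rewrite in_itv /= -ler_norml mxE.
    apply: (transition_root_le1 tA); rewrite chA root_prod_XsubC.
    by apply: mem_nth; rewrite szr.
  split; rewrite ?sqb // => l m lelm; rewrite !mxE.
  by apply: (sorted_leq_nth ge_trans (@lexx _ R) 0 srtr); rewrite ?inE ?szr.
have [b clb] := compact_fiber_closure cK clP fib.
have cA l m : continuous (fun t : 'M[R]_n.+1 * 'rV[R]_n.+1 => t.1 l m).
  move=> t; apply: (@continuous_comp _ _ _ fst (fun M : 'M[R]_n.+1 => M l m)).
    exact: cvg_fst.
  exact: coord_continuous.
have cb l : continuous (fun t : 'M[R]_n.+1 * 'rV[R]_n.+1 => t.2 0 l).
  move=> t; apply: (@continuous_comp _ _ _ snd (fun M : 'rV[R]_n.+1 => M 0 l)).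
    exact: cvg_snd.
  exact: coord_continuous.
have lim_ge0 (f : 'M[R]_n.+1 * 'rV[R]_n.+1 -> R) : continuous f ->
    (forall A c, Rel A c -> 0 <= f (A, c)) -> 0 <= f (P, b).
  move=> cf f0.
  have clf : closed (f @^-1` [set y | 0 <= y]).
    by apply: closed_comp => [z _|]; [exact: cf | exact: closed_ge].
  by apply: (clf (P, b)); apply: closure_subset clb => -[A c] /= /f0.
have srtb : sorted >=%R (sq b).
  rewrite sorted_map; apply: (@sub_sorted _ (relpre val leq)); last first.
    by rewrite -sorted_map val_enum_ord iota_sorted.
  move=> l m /= lelm; rewrite -subr_ge0.
  apply: (lim_ge0 (fun t => t.2 0 l - t.2 0 m)) => [t|A c [cm _ _]].
    by apply: continuousB; exact: cb.
  by rewrite subr_ge0 cm.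
have chb : char_poly P = \prod_(x <- sq b) ('X - x%:P).
  apply: poly_ext => x.
  pose g (t : 'M[R]_n.+1 * 'rV[R]_n.+1) := \det (x%:M - t.1).
  pose h (t : 'M[R]_n.+1 * 'rV[R]_n.+1) := \prod_(l <- enum 'I_n.+1) (x - t.2 0 l).
  pose f t := g t - h t.
  have cg : continuous g.
    apply: continuous_det => l m; under eq_fun do rewrite !mxE.
    by move=> t; apply: cvgB; [exact: cvg_cst | exact: cA].
  have ch : continuous h.
    by apply: continuous_bigprod => l t; apply: cvgB; [exact: cvg_cst | exact: cb].
  have cf : continuous f by move=> t; apply: continuousB; [exact: cg | exact: ch].
  have hE (c : 'rV[R]_n.+1) : (\prod_(y <- sq c) ('X - y%:P)).[x] =
      \prod_(l <- enum 'I_n.+1) (x - c 0 l).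
    by rewrite horner_prod big_map; apply: eq_bigr => l _; rewrite !hornerE.
  have f0 A c : Rel A c -> f (A, c) = 0.
    by move=> [_ chA _]; rewrite /f /g /h /= -horner_char_poly chA hE subrr.
  apply/eqP; rewrite horner_char_poly hE -subr_eq0 -[X in X == 0]/(f (P, b)).
  rewrite eq_le lim_ge0 // ?andbT => [|A c /f0 ->] //.
  rewrite -oppr_ge0; apply: (lim_ge0 (fun t => - f t)) => [t|A c /f0 ->]; rewrite ?oppr0 //.
    by apply: continuousN; exact: cf.
have -> : s = sq b.
  apply: (sorted_eq ge_trans ge_anti) => //.
  by apply: prod_XsubC_eq; rewrite -chP.
rewrite -map_drop.
apply: (lim_ge0 (fun t => shift_prod t.1 [seq t.2 0 l | l <- drop k (enum 'I_n.+1)] i j)).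
  exact: (@continuous_shift_prod _ ('M[R]_n.+1 * 'rV[R]_n.+1)%type _ _
    (fun t => t.1) (fun t l => t.2 0 l) (drop k (enum 'I_n.+1)) cA cb i j).
by move=> A c [_ _ pos] /=; rewrite map_drop.
Qed.

(** * Local equilibria *)

(** The local equilibria of [P]: the product of the [(P - b j) / (1 - b j)] for
    [j < m]. *)
Fixpoint local_equilibrium (F : fieldType) (N : nat) (P : 'M[F]_N) (b : nat -> F)
    (m : nat) : 'M[F]_N :=
  if m is m'.+1 then (1 - b m')^-1 *: ((P - (b m')%:M) *m local_equilibrium P b m')
  else 1%:M.

Lemma local_equilibriumE (F : fieldType) (N : nat) (P : 'M[F]_N) (b : nat -> F) (m : nat) :
  local_equilibrium P b m =
  (\prod_(j < m) (1 - b j)^-1) *: shift_prod P (rev (mkseq b m)).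
Proof.
elim: m => [|m IH]; first by rewrite /= /shift_prod big_nil big_ord0 scale1r.
rewrite /= IH big_ord_recr /= mkseqS rev_rcons shift_prod_cons -scalemxAr scalerA.
by rewrite mulrC.
Qed.

(** [P] acts on local equilibria as a pure birth chain: it holds at [m] with
    probability [b m], and otherwise moves to [m + 1]. *)
Lemma mul_local_equilibrium (F : fieldType) (N : nat) (P : 'M[F]_N) (b : nat -> F) (m : nat) :
  b m != 1 ->
  P *m local_equilibrium P b m =
  b m *: local_equilibrium P b m + (1 - b m) *: local_equilibrium P b m.+1.
Proof.
move=> bm; rewrite /= scalerA divff ?subr_eq0 1?eq_sym // scale1r.
by rewrite mulmxBl mul_scalar_mx addrC subrK.
Qed.

Lemma local_equilibrium_fixed (F : fieldType) (N p : nat) (P : 'M[F]_N) (b : nat -> F)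
    (m : nat) (u : 'M[F]_(N, p)) :
  (forall j, (j < m)%N -> b j != 1) -> P *m u = u -> local_equilibrium P b m *m u = u.
Proof.
move=> + Pu; elim: m => [_|m IH bm]; first exact: mul1mx.
rewrite /= -scalemxAl -mulmxA IH => [|j ltj]; last by apply: bm; exact: leqW.
rewrite mulmxBl Pu mul_scalar_mx.
have -> : u - b m *: u = (1 - b m) *: u by rewrite scalerBl scale1r.
by rewrite scalerA mulVf ?scale1r // subr_eq0 eq_sym bm.
Qed.

Lemma fixed_local_equilibrium (F : fieldType) (N p : nat) (P : 'M[F]_N) (b : nat -> F)
    (m : nat) (u : 'M[F]_(p, N)) :
  (forall j, (j < m)%N -> b j != 1) -> u *m P = u -> u *m local_equilibrium P b m = u.
Proof.
move=> + uP; elim: m => [_|m IH bm]; first exact: mulmx1.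
rewrite /= -scalemxAr mulmxA mulmxBr uP mul_mx_scalar.
have -> : u - b m *: u = (1 - b m) *: u by rewrite scalerBl scale1r.
rewrite -scalemxAl IH => [|j ltj].
  by rewrite scalerA mulVf ?scale1r // subr_eq0 eq_sym bm.
by apply: bm; exact: leqW.
Qed.

(** A matrix with nonzero adjugate has a kernel of dimension at most one. *)
Lemma adjugate_neq0_kernel (F : fieldType) (n : nat) (A : 'M[F]_n.+1) :
  \adj A != 0 ->
  exists i, forall w : 'cV[F]_n.+1, A *m w = 0 -> w i 0 = 0 -> w = 0.
Proof.
move=> adj0; have /existsP[i /existsP[j ij0]] : [exists i, exists j, \adj A i j != 0].
  apply: contraNT adj0; rewrite negb_exists => /forallP a0.
  apply/eqP/matrixP=> i j; rewrite [RHS]mxE; have := a0 i.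
  by rewrite negb_exists => /forallP/(_ j); rewrite negbK => /eqP.
exists i => w Aw wi; pose B := row' j (col' i A).
have Bu : B \in unitmx.
  rewrite unitmxE unitfE; apply: contra ij0 => /eqP detB.
  by rewrite mxE /cofactor detB mulr0.
have Bw : B *m row' i w = 0.
  apply/matrixP=> k l; have /matrixP/(_ (lift j k) l) := Aw.
  rewrite !mxE (bigD1_ord i) //= ord1 wi mulr0 add0r => E.
  by rewrite -[RHS]E; apply: eq_bigr => m _; rewrite !mxE.
have w0 : row' i w = 0 by rewrite -(mulKmx Bu (row' i w)) Bw mulmx0.
apply/matrixP=> k l; rewrite mxE ord1; case: (unliftP i k) => [m ->|-> //].
by have /matrixP/(_ m 0) := w0; rewrite !mxE.
Qed.

(** At the root [x], only the constant term of the Newton expansion survives. *)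
Lemma adjugate_at_first_root (R : idomainType) (n : nat) (M : 'M[R]_n) (x : R) (s : seq R) :
  char_poly M = \prod_(y <- x :: s) ('X - y%:P) ->
  \adj (x%:M - M) = shift_prod M s.
Proof.
move=> chM.
have -> : x%:M - M = map_mx (horner_eval x) (char_poly_mx M).
  apply/matrixP=> i j; rewrite !mxE /horner_eval !hornerE.
  by rewrite hornerMn hornerX.
rewrite -map_mx_adj (adjugate_newton chM) big_ord_recl /= drop0.
apply/matrixP=> i j; rewrite !mxE big_nil mul1r /horner_eval hornerD summxE.
rewrite horner_sum big1 ?addr0 ?mxE ?hornerC // => c _.
by rewrite !mxE big_cons !hornerE subrr !mul0r.
Qed.

(** All the rows of the last local equilibrium are [pi]. Its columns are
    harmonic by Cayley-Hamilton. It is proportional to the adjugate of [1 - P], and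
    nonzero since its rows sum to one, so harmonic vectors are constant. *)
Lemma local_equilibrium_last (R : realType) (n : nat) (P : 'M[R]_n.+1) (pi : 'rV[R]_n.+1)
    (b : nat -> R) :
  transition_matrix P -> stationary P pi ->
  char_poly P = \prod_(x <- rev (mkseq b n.+1)) ('X - x%:P) ->
  (forall j, (j < n)%N -> b j < 1) -> b n = 1 ->
  forall x y, local_equilibrium P b n x y = pi 0 y.
Proof.
move=> [_ P1] [[_ pi1] piP] chP bn b1; set Q := local_equilibrium P b n.
have bn1 j : (j < n)%N -> b j != 1 by move=> /bn ?; rewrite lt_eqF.
pose u : 'cV[R]_n.+1 := const_mx 1.
have Pu : P *m u = u.
  apply/matrixP=> x y; rewrite !mxE -[RHS](P1 x).
  by apply: eq_bigr => z _; rewrite mxE mulr1.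
have Qu : Q *m u = u by exact: local_equilibrium_fixed.
have PQ : P *m Q = Q.
  apply/eqP; rewrite -subr_eq0 -[X in _ - X]mul1mx -mulmxBl /Q local_equilibriumE.
  rewrite -scalemxAr -[in 1%:M]b1 -shift_prod_cons -rev_rcons -mkseqS.
  by rewrite (shift_prod_annihilates chP) scaler0.
have [i ker] : exists i, forall w : 'cV[R]_n.+1, (1%:M - P) *m w = 0 -> w i 0 = 0 -> w = 0.
  apply: adjugate_neq0_kernel; rewrite -b1.
  rewrite (@adjugate_at_first_root _ _ P (b n) (rev (mkseq b n))); last first.
    by rewrite -rev_rcons -mkseqS.
  apply/eqP => q0; have := Qu; rewrite /Q local_equilibriumE q0 scaler0 mul0mx.
  by move/matrixP/(_ 0 0); rewrite !mxE => /esym/eqP; rewrite oner_eq0.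
have Qcst x y : Q x y = Q i y.
  pose w := col y Q - (Q i y) *: u.
  have : w = 0.
    apply: ker; last by rewrite !mxE mulr1 subrr.
    have Pc : P *m col y Q = col y Q.
      apply/matrixP=> z k; rewrite [RHS]mxE -[in RHS]PQ !mxE.
      by apply: eq_bigr => l _; rewrite mxE.
    by rewrite mulmxBl mul1mx mulmxBr -scalemxAr Pu Pc subrr.
  by move/matrixP/(_ x 0); rewrite !mxE mulr1 => /eqP; rewrite subr_eq0 => /eqP.
move=> x y; have /rowP/(_ y) : pi *m Q = pi by exact: fixed_local_equilibrium.
rewrite mxE => <-; rewrite (eq_bigr (fun z => pi 0 z * Q x y)) => [|z _].
  by rewrite -mulr_suml pi1 mul1r.
by rewrite (Qcst x) (Qcst z).
Qed.

(** The probability that a sum of independent geometric variables with failure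
    probabilities [s] is at most [t]; [k] is the number of failures of the first
    variable, whose value is [k + 1]. *)
Fixpoint geometric_sum_cdf (R : nzRingType) (s : seq R) (t : nat) : R :=
  if s is x :: s' then \sum_(k < t) x ^+ k * (1 - x) * geometric_sum_cdf s' (t - k.+1)
  else 1.

Lemma geometric_sum_cdfS (R : comNzRingType) (x : R) (s : seq R) (t : nat) :
  geometric_sum_cdf (x :: s) t.+1 =
  x * geometric_sum_cdf (x :: s) t + (1 - x) * geometric_sum_cdf s t.
Proof.
rewrite /= big_ord_recl /= expr0 mul1r subSS subn0 addrC; congr (_ + _).
by rewrite mulr_sumr; apply: eq_bigr => k _; rewrite exprS !mulrA subSS.
Qed.

(** The pure birth chain started at [m] is absorbed at [n] by time [t] with
    probability [geometric_sum_cdf (drop m _) t]; the nonabsorbed part contributes a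
    nonnegative matrix. *)
Lemma geometric_sum_cdf_bound (R : realType) (n : nat) (P : 'M[R]_n.+1) (pi : 'rV[R]_n.+1)
    (b : nat -> R) (m t : nat) :
  (forall j, (j <= n)%N -> forall x y, 0 <= local_equilibrium P b j x y) ->
  (forall x y, local_equilibrium P b n x y = pi 0 y) ->
  P *m local_equilibrium P b n = local_equilibrium P b n ->
  (forall j, (j < n)%N -> 0 <= b j < 1) -> (m <= n)%N ->
  forall x y, geometric_sum_cdf (drop m (mkseq b n)) t * pi 0 y <=
    (P ^+ t *m local_equilibrium P b m) x y.
Proof.
move=> Q0 Qn PQn b01; elim: t m => [|t IH] m; rewrite leq_eqVlt => /predU1P[->|ltm] x y.
- by rewrite drop_oversize ?size_mkseq //= mul1r mul1mx Qn.
- rewrite mul1mx (drop_nth 0) ?size_mkseq //= big_ord0 mul0r.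
  exact: Q0 (ltnW ltm) x y.
- rewrite exprSr -mulmxA PQn.
  have := IH n (leqnn n) x y.
  by rewrite drop_oversize ?size_mkseq.
have /andP[b0 b1] := b01 m ltm.
have dropE : drop m (mkseq b n) = b m :: drop m.+1 (mkseq b n).
  by rewrite (drop_nth 0) ?size_mkseq // nth_mkseq.
have leQ := IH m (ltnW ltm) x y; have leQ1 := IH m.+1 ltm x y.
have stepQ := mul_local_equilibrium P (negbT (lt_eqF b1)).
move: (local_equilibrium P b m.+1) stepQ leQ1 => Q1 stepQ leQ1.
rewrite exprSr -mulmxA stepQ mulmxDr -!scalemxAr [leRHS]mxE.
rewrite [X in _ <= X + _]mxE [X in _ <= _ + X]mxE.
rewrite dropE geometric_sum_cdfS mulrDl -dropE -!mulrA.
by apply: lerD; [apply: ler_wpM2l | apply: ler_wpM2l => //; rewrite subr_ge0 ltW].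
Qed.

(** * Sums of independent geometric variables *)

Lemma sum_geometric_weights (R : comNzRingType) (x : R) (K : nat) :
  \sum_(k < K) x ^+ k * (1 - x) = 1 - x ^+ K.
Proof.
elim: K => [|K IH]; first by rewrite big_ord0 expr0 subrr.
by rewrite big_ord_recr /= IH mulrBr mulr1 -exprSr addrA subrK.
Qed.

Section Geometric.
Context (d : measure_display) (Omega : measurableType d) (R : realType)
  (Pr : probability Omega R).

Lemma measurable_rv_fiber (X : {RV Pr >-> nat}) (A : set nat) : measurable (X @^-1` A).
Proof. exact: measurable_funPTI. Qed.

(** The law is only prescribed on positive integers, where it already has total
    mass one. *)
Lemma geometric_rv_eq0 (X : {RV Pr >-> nat}) (x : R) :
  0 <= x < 1 -> geometric_rv X x -> Pr (X @^-1` [set 0%N]) = 0%E.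
Proof.
move=> /andP[x0 x1] geo; set p := Pr _.
have pfin : p \is a fin_num by apply: fin_num_measure; exact: measurable_rv_fiber.
have le_pow K : fine p <= x ^+ K.
  have := probability_le1 Pr (measurable_rv_fiber X [set k | (k < K.+1)%N]).
  have -> : X @^-1` [set k | (k < K.+1)%N] = \big[setU/set0]_(k < K.+1) (X @^-1` [set (k : nat)]).
    rewrite -(bigcup_mkord K.+1 (fun k => X @^-1` [set k])).
    apply/seteqP; split=> [w /= lt|w [k /= lt ->] //].
    by exists (X w).
  rewrite measure_semi_additive_ord; first last.
  - by apply: bigsetU_measurable => k _; exact: measurable_rv_fiber.
  - apply/trivIsetP => i j _ _ /eqP neq; apply/seteqP; split=> w //= -[Xi Xj].
    by apply: neq; apply: val_inj; rewrite /= -Xi -Xj.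
  - by move=> k; exact: measurable_rv_fiber.
  rewrite big_ord_recl /= -/p (eq_bigr (fun k : 'I_K => (x ^+ k * (1 - x))%:E)); last first.
    by move=> k _; rewrite geo.
  rewrite sumEFin sum_geometric_weights -(fineK pfin) -EFinD lee_fin.
  by rewrite addrCA gerDl subr_le0.
have p_ge0 : 0 <= fine p by apply: fine_ge0; exact: measure_ge0.
rewrite -(fineK pfin); congr EFin; apply/le_anti; rewrite p_ge0 andbT.
have cv : (fun K => x ^+ K) @ \oo --> 0 by apply: cvg_expr; rewrite ger0_norm.
rewrite -(cvg_lim (@Rhausdorff R) cv).
apply: limr_ge; first by apply/cvg_ex; exists 0.
by apply: nearW => K.
Qed.

(** The distribution function of a sum of independent geometric variables. The
    proof generalizes to the event that the sum of the variables of index at least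
    [m] is at most [u] while the earlier ones have prescribed values; for [m = n]
    this is independence, and smaller [m] follow by conditioning on [tau m]. *)
Lemma geometric_sum_law (n : nat) (tau : 'I_n -> {RV Pr >-> nat}) (b : nat -> R) :
  mutually_independent tau -> (forall j : 'I_n, geometric_rv (tau j) (b j)) ->
  (forall j, (j < n)%N -> 0 <= b j < 1) -> forall t,
  measurable [set w | (\sum_(j < n) tau j w <= t)%N] /\
  Pr [set w | (\sum_(j < n) tau j w <= t)%N] = (geometric_sum_cdf (mkseq b n) t)%:E.
Proof.
move=> ind geo b01 t.
pose p (j : 'I_n) k := fine (Pr (tau j @^-1` [set k])).
have pE j k : Pr (tau j @^-1` [set k]) = (p j k)%:E.
  by rewrite fineK //; apply: fin_num_measure; exact: measurable_rv_fiber.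
pose E m (f : nat -> nat) u := [set w | (forall j : 'I_n, (j < m)%N -> tau j w = f j) /\
  (\sum_(j < n | (m <= j)%N) tau j w <= u)%N].
have key r m f u : (m + r)%N = n -> measurable (E m f u) /\
    Pr (E m f u) =
      (\prod_(j < n | (j < m)%N) p j (f j) * geometric_sum_cdf (drop m (mkseq b n)) u)%:E.
  elim: r m f u => [|r IH] m f u.
    rewrite addn0 => ->.
    have EE : E n f u = \bigcap_(j in [set` [set: 'I_n]%SET]) (tau j @^-1` [set f j]).
      apply/seteqP; split=> [w [wf _] j _|w wf]; first exact: wf.
      split=> [j _|]; first by apply: wf; rewrite /= inE.
      by rewrite big1 // => j; rewrite leqNgt ltn_ord.
    split.
      rewrite EE; apply: fin_bigcap_measurable; first exact: finite_finset.
      by move=> j _; exact: measurable_rv_fiber.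
    rewrite EE (ind [set: 'I_n]%SET (fun j : 'I_n => [set f j])) // drop_oversize ?size_mkseq //= mulr1.
    rewrite (eq_bigr (fun j => (p j (f j))%:E)) // -prodEFin.
    by apply: eq_bigl => j; rewrite inE ltn_ord.
  move=> mr; have ltm : (m < n)%N by rewrite -mr addnS ltnS leq_addr.
  pose jm := Ordinal ltm.
  (* The prescribed values, with [tau m] now prescribed to be [k]. *)
  pose g (k : nat) := fun i : nat => if i == m then k else f i.
  have splitm w : (\sum_(j < n | (m <= j)%N) tau j w =
      tau jm w + \sum_(j < n | (m.+1 <= j)%N) tau j w)%N.
    rewrite (bigD1 jm) //=; congr addn; apply: eq_bigl => j.
    by rewrite ltn_neqAle andbC eq_sym.
  have EE : E m f u = \big[setU/set0]_(k < u.+1) E m.+1 (g k) (u - k)%N.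
    rewrite -(bigcup_mkord u.+1 (fun k => E m.+1 (g k) (u - k)%N)); apply/seteqP; split=> w.
      move=> [wf ws]; rewrite splitm in ws.
      have lek : (tau jm w <= u)%N by exact: leq_trans (leq_addr _ _) ws.
      exists (tau jm w) => //; split; last by rewrite leq_subRL.
      move=> j; rewrite ltnS /g leq_eqVlt; case: eqP => [jE _|_ /wf //].
      by congr (tau _ w); exact: val_inj.
    move=> [k /= ltk [wf ws]].
    have km : tau jm w = k by rewrite wf //= /g eqxx.
    split=> [j ltj|]; last by rewrite splitm km -leq_subRL.
    by rewrite wf; [rewrite /g (ltn_eqF ltj) | exact: leqW].
  have IHk k : measurable (E m.+1 (g k) (u - k)%N) /\ Pr (E m.+1 (g k) (u - k)%N) =
      (\prod_(j < n | (j < m)%N) p j (f j) *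
       (p jm k * geometric_sum_cdf (drop m.+1 (mkseq b n)) (u - k)))%:E.
    have [mE ->] := IH m.+1 (g k) (u - k)%N (etrans (addSnnS _ _) mr); split=> //.
    rewrite mulrA; congr (_ * _)%:E; rewrite (bigD1 jm) //= mulrC /g eqxx; congr (_ * _).
    rewrite (eq_bigl (fun j : 'I_n => (j < m)%N)) => [|j]; last first.
      by rewrite ltnS ltn_neqAle andbC.
    by apply: eq_bigr => j ltj; rewrite (ltn_eqF ltj).
  have mU : measurable (E m f u).
    by rewrite EE; apply: bigsetU_measurable => k _; exact: (IHk k).1.
  split=> //; rewrite EE measure_semi_additive_ord; first last.
  - by rewrite -EE.
  - apply/trivIsetP => k l _ _ /eqP neq; apply/seteqP; split=> w //= -[[wk _] [wl _]].
    apply: neq; apply: val_inj.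
    by have := wk jm (leqnn _); rewrite (wl jm (leqnn _)) /g eqxx.
  - by move=> k; exact: (IHk k).1.
  rewrite (eq_bigr _ (fun (k : 'I_u.+1) _ => (IHk k).2)) sumEFin -mulr_sumr.
  congr (_ * _)%:E.
  have -> : drop m (mkseq b n) = b m :: drop m.+1 (mkseq b n).
    by rewrite (drop_nth 0) ?size_mkseq // nth_mkseq.
  rewrite big_ord_recl /=.
  rewrite {1}/p (geometric_rv_eq0 (b01 m ltm)) //= mul0r add0r.
  by apply: eq_bigr => k _; rewrite /p geo.
have [] := key n 0%N (fun=> 0%N) t (add0n n).
have -> : E 0%N (fun=> 0%N) t = [set w | (\sum_(j < n) tau j w <= t)%N].
  by apply/seteqP; split=> [w [_ /=]|w /= le] //; split.
by move=> mE ->; split=> //; rewrite big_pred0 // mul1r drop0.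
Qed.
End Geometric.

(** * Separation *)

Lemma separation_bound (R : realType) (n : nat) (P : 'M[R]_n.+1) (pi mu : 'rV[R]_n.+1)
    (b : nat -> R) (t : nat) (y : 'I_n.+1) :
  transition_matrix P -> closure (reversible_matrices : set 'M[R]_n.+1) P ->
  stationary P pi ->
  char_poly P = \prod_(x <- rev (mkseq b n.+1)) ('X - x%:P) ->
  sorted <=%R (mkseq b n.+1) ->
  (forall j, (j < n)%N -> 0 <= b j < 1) -> b n = 1 -> prob_vector mu ->
  geometric_sum_cdf (mkseq b n) t * pi 0 y <= (mu *m P ^+ t) 0 y.
Proof.
move=> tP clP stP chP srt b01 b1 [mu0 mu1].
have blt j : (j < n)%N -> b j < 1 by move=> /b01 /andP[].
have srt' : sorted >=%R (rev (mkseq b n.+1)) by rewrite rev_sorted.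
have Q0 j : (j <= n)%N -> forall x z, 0 <= local_equilibrium P b j x z.
  move=> lej x z; rewrite local_equilibriumE mxE mulr_ge0 //.
    apply: prodr_ge0 => i _; rewrite invr_ge0 subr_ge0 ltW //.
    by apply: blt; exact: leq_trans lej.
  have -> : rev (mkseq b j) = drop (n.+1 - j) (rev (mkseq b n.+1)).
    rewrite drop_rev size_mkseq subKn; last exact: leqW.
    by rewrite /mkseq -map_take take_iota (minn_idPl (leqW lej)).
  exact: closure_reversible_shift_prod_ge0.
have Qn := local_equilibrium_last tP stP chP blt b1.
have PQn : P *m local_equilibrium P b n = local_equilibrium P b n.
  apply/matrixP=> x z; rewrite mxE Qn -[RHS]mul1r -(tP.2 x) mulr_suml.
  by apply: eq_bigr => k _; rewrite Qn.
rewrite mxE -[leLHS]mul1r -mu1 mulr_suml; apply: ler_sum => x _.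
apply: ler_wpM2l => //.
have := geometric_sum_cdf_bound t Q0 Qn PQn b01 (leq0n n) x y.
by rewrite drop0 /= mulmx1.
Qed.

Unset Implicit Arguments.

Theorem theorem1p4 (R : realType) (n : nat) (P : 'M[R]_n.+1) (pi : 'rV[R]_n.+1)
    (beta : 'I_n.+1 -> R)
    (d : measure_display) (Omega : measurableType d) (Pr : probability Omega R)
    (tau : 'I_n -> {RV Pr >-> nat}) (mu : 'rV[R]_n.+1) (t : nat) :
  transition_matrix P ->
  closure (reversible_matrices : set 'M[R]_n.+1) P ->
  stationary P pi ->
  reversible P pi ->
  char_poly P = \prod_(j < n.+1) ('X - (beta j)%:P) ->
  (forall j, 0 <= beta j) ->
  (forall i j : 'I_n.+1, (i <= j)%N -> beta i <= beta j) ->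
  (forall j : 'I_n, beta (widen_ord (leqnSn n) j) < 1) ->
  beta ord_max = 1 ->
  mutually_independent tau ->
  (forall j : 'I_n, geometric_rv (tau j) (beta (widen_ord (leqnSn n) j))) ->
  prob_vector mu ->
  (dsep (mu *m P ^+ t) pi <=
     Pr [set w | (t < \sum_(j < n) tau j w)%N])%E.
Proof.
move=> tP clP stP _ chP beta0 le_beta beta1 betamax ind geo pmu.
pose b (k : nat) := beta (inord k).
have bwiden (j : 'I_n) : b j = beta (widen_ord (leqnSn n) j).
  by congr beta; apply: val_inj; rewrite /= inordK // ltnS ltnW.
have b01 j : (j < n)%N -> 0 <= b j < 1.
  by move=> ltj; rewrite beta0 -[j]/(val (Ordinal ltj)) bwiden beta1.
have chP' : char_poly P = \prod_(x <- rev (mkseq b n.+1)) ('X - x%:P).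
  rewrite chP (perm_big (mkseq b n.+1)) ?perm_rev //= big_map.
  rewrite -[iota 0 n.+1]/(index_iota 0 n.+1) big_mkord.
  by apply: eq_bigr => j _; rewrite /b inord_val.
have srt : sorted <=%R (mkseq b n.+1).
  apply/(sortedP 0) => k; rewrite size_mkseq => ltk.
  rewrite !nth_mkseq //; last exact: ltnW.
  by apply: le_beta; rewrite !inordK // ltnW.
have bmax : b n = 1 by rewrite -betamax; congr beta; apply: val_inj; rewrite /= inordK.
have geo' (j : 'I_n) : geometric_rv (tau j) (b j) by rewrite bwiden.
have [mE PE] := geometric_sum_law ind geo' b01 t.
have -> : [set w | (t < \sum_(j < n) tau j w)%N] =
    ~` [set w | (\sum_(j < n) tau j w <= t)%N].
  by apply/seteqP; split=> w /=; rewrite ltnNge => /negP.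
rewrite probability_setC // PE -EFinB.
apply: (big_ind (fun u => (u <= _)%E)) => [|u v uC vC|x pix].
- exact: leNye.
- by rewrite ge_max uC vC.
rewrite lee_fin lerD2l lerN2 ler_pdivlMr //.
exact: separation_bound.
Qed.
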